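(* Let $\mathbf{k}$ be a field of characteristic zero and let $(i,j)$ be a fixed pair of positive integers with $\gcd(i,j)=1$. Then the elements of the infinite set of embeddings $$\mathcal{K}_{(i,j)}:=\{(T_i,T_j,T_k):\mathbb{A}^1\to\mathbb{A}^3 \mid k\ge1,\ \mathrm{pgcd}(i,j,k)=1\}$$ represent a finite number of algebraic equivalence classes. Consequently, when $\mathbf{k}=\mathbb{R}$, $\mathcal{K}_{(i,j)}$ is t-finite, i.e. its elements represent a finite number of knot types.
   Context: $T_n$ denotes the degree-$n$ Chebyshev polynomial of the first kind: $T_0=1$, $T_1=t$, $T_{n+1}=2tT_n-T_{n-1}$ for $n\ge1$, regarded as an element of $\mathbf{k}[t]$. For positive integers, $\mathrm{pgcd}(i,j,k)=\max\{\gcd(i,j),\gcd(i,k),\gcd(j,k)\}$. A morphism $\phi=(f_1,f_2,f_3):\mathbb{A}^1\to\mathbb{A}^3$ is an embedding iff $\mathbf{k}[f_1,f_2,f_3]=\mathbf{k}[t]$. Two embeddings $\phi,\psi:\mathbb{A}^1\to\mathbb{A}^3$ are algebraically equivalent if there is a polynomial automorphism $\alpha\in GA_3(\mathbf{k})$ of $\mathbb{A}^3$ with $\alpha\phi=\psi$. Over $\mathbb{R}$, embedded polynomial lines in $\mathbb{R}^3$ are regarded as knots (adding the point at infinity gives a knot in $S^3$), and two of them have the same knot type if they are topologically equivalent, meaning there is a homeomorphism of $\mathbb{R}^3$ to itself carrying one embedded line to the other (so a knot is not distinguished from its mirror image). A set of knots is t-finite if its elements represent only finitely many knot types. *)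

(* Defs.v *)
From mathcomp Require Import all_boot all_order all_algebra.
(* The notations of mpoly are incompatible with those of the analysis library. *)
From mathcomp Require Import -(notations) mpoly.
From mathcomp Require Import all_classical reals topology normedtype.
Import numFieldNormedType.Exports.

Set Implicit Arguments.
Unset Strict Implicit.
Unset Printing Implicit Defensive.

Import GRing.Theory Num.Theory.

Local Open Scope classical_set_scope.
Local Open Scope ring_scope.

Section Embeddings.
Variable k : fieldType.

(* A morphism A^1 -> A^3, given by its three coordinate polynomials. *)
Definition morph : Type := 3.-tuple {poly k}.

(* g(f_1, f_2, f_3), for g in k[x_1, x_2, x_3]. *)
Definition subst_morph (g : mpoly 3 k) (f : morph) : {poly k} :=
  mmap (@polyC k) (tnth f) g.

(* k[f_1, f_2, f_3] = k[t]. *)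
Definition embedding (f : morph) : Prop :=
  forall p : {poly k}, exists g : mpoly 3 k, subst_morph g f = p.

(* A polynomial self-map of A^3 is given by its three components;
   comp_endo a b is a after b. *)
Definition endo : Type := 3.-tuple (mpoly 3 k).

Definition id_endo : endo := [tuple mpolyX k (mnm1 l) | l < 3].

Definition comp_endo (a b : endo) : endo := [tuple comp_mpoly b (tnth a l) | l < 3].

Definition poly_automorphism (a : endo) : Prop :=
  exists b : endo, comp_endo a b = id_endo /\ comp_endo b a = id_endo.

Definition act_endo (a : endo) (f : morph) : morph :=
  [tuple subst_morph (tnth a l) f | l < 3].

Definition alg_equiv (f g : morph) : Prop :=
  exists a : endo, poly_automorphism a /\ act_endo a f = g.

Definition alg_class (f : morph) : set morph :=
  [set g | embedding g /\ alg_equiv f g].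

End Embeddings.

Section Knots.
Variable R : realType.

Definition line (f : morph R) : set 'rV[R]_3 :=
  range (fun t : R => \row_(l < 3) (tnth f l).[t]).

(* A homeomorphism of R^3 onto itself, orientation-preserving or not. *)
Definition homeomorphism (h : 'rV[R]_3 -> 'rV[R]_3) : Prop :=
  continuous h /\
  exists h' : 'rV[R]_3 -> 'rV[R]_3,
    [/\ continuous h', cancel h h' & cancel h' h].

Definition top_equiv (f g : morph R) : Prop :=
  exists h : 'rV[R]_3 -> 'rV[R]_3, homeomorphism h /\ h @` line f = line g.

Definition knot_type (f : morph R) : set (morph R) :=
  [set g | embedding g /\ top_equiv f g].

Definition t_finite (S : set (morph R)) : Prop :=
  finite_set [set knot_type f | f in S].

End Knots.

Fixpoint chebT (k : fieldType) (n : nat) : {poly k} :=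
  if n is n1.+1 then
    if n1 is n2.+1 then 2%:R *: 'X * chebT k n1 - chebT k n2 else 'X
  else 1.

Definition pgcd (i j k : nat) : nat :=
  maxn (gcdn i j) (maxn (gcdn i k) (gcdn j k)).

Definition chebK (k : fieldType) (i j : nat) : set (morph k) :=
  [set f | exists n : nat, [/\ (1 <= n)%N, pgcd i j n = 1%N
     & f = [tuple chebT k i; chebT k j; chebT k n]]].

Arguments chebK k i j : clear implicits.

(* Main.v *)
(* The product formula 2 T_a T_b = T_(a + b) + T_(a - b) and Bezout's identity
   show that T_(m + 2 i j) - T_m lies in k[T_i, T_j]. Hence a shear
   (x, y, z) |-> (x, y, z + g(x, y)) moves (T_i, T_j, T_m) to
   (T_i, T_j, T_(m + 2 i j)), and the class of (T_i, T_j, T_n) depends only on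
   n mod 2 i j. The same congruence gives the embedding property: one of j, n is
   odd, hence invertible modulo twice the product of the other two indices. Over
   the reals, polynomial automorphisms are homeomorphisms. *)
Require Import Defs.
From mathcomp Require Import all_boot all_order all_algebra.
From mathcomp Require Import -(notations) mpoly.
From mathcomp Require Import ring zify.
From mathcomp Require Import all_classical reals topology normedtype realfun.

Set Implicit Arguments.
Unset Strict Implicit.
Unset Printing Implicit Defensive.

Import GRing.Theory.
Import numFieldNormedType.Exports.
Local Open Scope ring_scope.

(** * Ring morphisms out of a polynomial ring in several variables *)

Section MpolyMorphisms.
Variable n : nat.

(** Constants and variables generate the polynomial ring. This turns the composition laws for
    substitution and evaluation below into checks on generators. *)
Lemma eq_mpoly_rmorphism (R : comNzRingType) (S : nzRingType)
    (F G : {rmorphism mpoly n R -> S}) :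
  (forall c, F (mpolyC n c) = G (mpolyC n c)) ->
  (forall l, F (mpolyX R (mnm1 l)) = G (mpolyX R (mnm1 l))) -> F =1 G.
Proof.
move=> eqC eqX p; rewrite (mpolyE p) !rmorph_sum; apply: eq_bigr => m _.
rewrite -mul_mpolyC mpolyXE_id !rmorphM eqC; congr (_ * _).
rewrite !rmorph_prod; apply: eq_bigr => l _.
by rewrite !rmorphXn eqX.
Qed.

Lemma comp_mpolyA (R : comNzRingType) m l (c : m.-tuple (mpoly l R))
    (b : n.-tuple (mpoly m R)) (p : mpoly n R) :
  comp_mpoly c (comp_mpoly b p) =
  comp_mpoly [tuple comp_mpoly c (tnth b s) | s < n] p.
Proof.
apply: (@eq_mpoly_rmorphism _ _ (comp_mpoly c \o comp_mpoly b)) p => [a|s] /=.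
  by rewrite !comp_mpolyC.
by rewrite !comp_mpolyXU -!tnth_nth tnth_mktuple.
Qed.

End MpolyMorphisms.

(** * Polynomial automorphisms of affine 3-space, algebraic equivalence and shears *)

Section Automorphisms.
Variable k : fieldType.
Implicit Types (f g h : morph k) (a b c : endo k) (p q : {poly k}).

Local Notation X l := (mpolyX k (mnm1 (l : 'I_3))).

Lemma subst_morph_comp (G : mpoly 3 k) b f :
  subst_morph (comp_mpoly b G) f = subst_morph G (act_endo b f).
Proof.
apply: (@eq_mpoly_rmorphism _ _ _ (mmap (@polyC k) (tnth f) \o comp_mpoly b)
  (mmap (@polyC k) (tnth (act_endo b f)))) G => [x|s] /=.
  by rewrite comp_mpolyC !mmapC.
by rewrite comp_mpolyXU -tnth_nth !mmapX !mmap1U tnth_mktuple.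
Qed.

Lemma subst_morphX l f : subst_morph (X l) f = tnth f l.
Proof. by rewrite /subst_morph mmapX mmap1U. Qed.

Lemma subst_morphD G H f : subst_morph (G + H) f = subst_morph G f + subst_morph H f.
Proof. exact: mmapD. Qed.

Lemma subst_morphB G H f : subst_morph (G - H) f = subst_morph G f - subst_morph H f.
Proof. exact: mmapB. Qed.

Lemma subst_morphM G H f : subst_morph (G * H) f = subst_morph G f * subst_morph H f.
Proof. exact: (rmorphM (mmap (@polyC k) (tnth f))). Qed.

Lemma act_comp_endo a b f : act_endo (comp_endo a b) f = act_endo a (act_endo b f).
Proof.
by apply: eq_from_tnth => l; rewrite !tnth_mktuple subst_morph_comp.
Qed.

Lemma act_id_endo f : act_endo (id_endo k) f = f.
Proof. by apply: eq_from_tnth => l; rewrite !tnth_mktuple subst_morphX. Qed.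

Lemma comp_endoA a b c : comp_endo a (comp_endo b c) = comp_endo (comp_endo a b) c.
Proof. by apply: eq_from_tnth => l; rewrite !tnth_mktuple comp_mpolyA. Qed.

Lemma comp_id_endo a : comp_endo (id_endo k) a = a.
Proof.
by apply: eq_from_tnth => l; rewrite !tnth_mktuple comp_mpolyXU -tnth_nth.
Qed.

Lemma alg_equiv_sym f g : alg_equiv f g -> alg_equiv g f.
Proof.
move=> [a [[b [ab ba]] <-]]; exists b; split; first by exists a.
by rewrite -act_comp_endo ba act_id_endo.
Qed.

Lemma alg_equiv_trans g f h : alg_equiv f g -> alg_equiv g h -> alg_equiv f h.
Proof.
move=> [a [[a' [aa' a'a]] <-]] [b [[b' [bb' b'b]] <-]].
exists (comp_endo b a); split; last by rewrite act_comp_endo.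
exists (comp_endo a' b'); split.
  by rewrite -comp_endoA (comp_endoA a) aa' comp_id_endo.
by rewrite -comp_endoA (comp_endoA b') b'b comp_id_endo.
Qed.

Lemma eq_alg_class f g : alg_equiv f g -> alg_class f = alg_class g.
Proof.
move=> fg; apply/seteqP; split=> h [emb_h eqh]; split=> //.
  exact: alg_equiv_trans (alg_equiv_sym fg) eqh.
exact: alg_equiv_trans fg eqh.
Qed.

(** This is [p(G)]; taking for [G] a variable gives polynomials in that variable alone. *)
Definition mpoly_of_poly (G : mpoly 3 k) p : mpoly 3 k :=
  (map_poly (@mpolyC 3 k) p).[G].

Lemma subst_mpoly_of_poly G p f :
  subst_morph (mpoly_of_poly G p) f = p \Po subst_morph G f.
Proof.
rewrite /mpoly_of_poly /subst_morph -horner_map -map_poly_comp; congr (_.[_]).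
by apply: eq_map_poly => x /=; rewrite mmapC.
Qed.

Lemma comp_mpoly_of_poly b G p :
  comp_mpoly b (mpoly_of_poly G p) = mpoly_of_poly (comp_mpoly b G) p.
Proof.
rewrite /mpoly_of_poly -horner_map -map_poly_comp; congr (_.[_]).
by apply: eq_map_poly => x /=; rewrite comp_mpolyC.
Qed.

Definition shear (G : mpoly 3 k) : endo k :=
  [tuple X 0; X 1; X 2%:R + G].

Lemma comp_shear (G H : mpoly 3 k) : comp_mpoly (shear H) G = G ->
  comp_endo (shear G) (shear H) = shear (G + H).
Proof.
move=> GH; apply: eq_from_tnth => l; rewrite tnth_mktuple !(tnth_nth 0).
by case: l => [[|[|[|l]]] ltl] //=; rewrite ?comp_mpolyD ?comp_mpolyXU //= GH addrAC addrA.
Qed.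

Lemma shear0 : shear 0 = id_endo k.
Proof.
apply: eq_from_tnth => l; rewrite tnth_mktuple !(tnth_nth 0).
by case: l => [[|[|[|l]]] ltl] //=; rewrite ?addr0; congr (mpolyX _ (mnm1 _));
  apply: val_inj.
Qed.

(** The hypothesis encodes that [G] does not involve the third variable [z]: the choice [H = - z]
    already gives [G(x, y, 0) = G]. The inverse is then the shear by [- G]. *)
Lemma shear_automorphism (G : mpoly 3 k) :
  (forall H, comp_mpoly (shear H) G = G) -> poly_automorphism (shear G).
Proof.
move=> GX; exists (shear (- G)); rewrite !comp_shear ?comp_mpolyN ?GX //.
by rewrite subrr addNr shear0.
Qed.

(** The added term is a polynomial in the first two coordinates, so a shear produces it. Its shape
    is the one in which [chebT_shift] delivers the difference of two Chebyshev polynomials. *)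
Lemma alg_equiv_add (x y z p q p' q' : {poly k}) :
  alg_equiv [tuple x; y; z]
    [tuple x; y; z + ((p \Po x) * (q \Po y) - (p' \Po x) * (q' \Po y))].
Proof.
pose G := mpoly_of_poly (X 0) p * mpoly_of_poly (X 1) q
        - mpoly_of_poly (X 0) p' * mpoly_of_poly (X 1) q'.
exists (shear G); split.
  apply: shear_automorphism => H.
  by rewrite /G rmorphB !rmorphM /= !comp_mpoly_of_poly !comp_mpolyXU.
apply: eq_from_tnth => l; rewrite tnth_mktuple !(tnth_nth 0).
case: l => [[|[|[|l]]] ltl] //=; rewrite ?subst_morphX //.
by rewrite subst_morphD subst_morphB !subst_morphM !subst_mpoly_of_poly !subst_morphX.
Qed.

End Automorphisms.

(** * Chebyshev identities *)

Section Chebyshev.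
Variable k : fieldType.
Implicit Types (f : morph k) (p q : {poly k}) (a b i j m n : nat).

Local Notation T := (chebT k).

Lemma chebTSS n : T n.+2 = 'X * T n.+1 *+ 2 - T n.
Proof. by rewrite /= -scalerAl scaler_nat. Qed.

(** The product formula with [a = n + m] and [b = m], so that [a - b] needs no truncated
    subtraction. *)
Lemma chebT_mul n m : T (n + m) * T m *+ 2 = T (n + m + m) + T n.
Proof.
(* The recurrence has order two, so the induction carries [m] and [m + 1] together, for all [n]. *)
suff [] : (forall n, T (n + m) * T m *+ 2 = T (n + m + m) + T n) /\
    (forall n, T (n + m.+1) * T m.+1 *+ 2 = T (n + m.+1 + m.+1) + T n) by [].
elim: m {n} => [|m [IHm IHm1]]; split=> // n.
- by rewrite !addn0 mulr1.
- by rewrite !addn1 chebTSS subrK mulrC.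
(* Expanding [T_(m + 2)] leaves the factor [T_(n + m + 2)] fixed, so the induction hypotheses are
   used at [n + 1] and [n + 2]. *)
- have E1 : T (n + m.+2) * T m.+1 *+ 2 = T (n.+1 + m.+1 + m.+1) + T n.+1.
    by rewrite addnS -addSn IHm1.
  have E0 : T (n + m.+2) * T m *+ 2 = T (n.+2 + m + m) + T n.+2.
    by rewrite 2!addnS -2!addSn IHm.
  transitivity ('X * (T (n + m.+2) * T m.+1 *+ 2) *+ 2 - T (n + m.+2) * T m *+ 2).
    by rewrite (chebTSS m); ring.
  by rewrite E1 E0 !addnS !addSn (chebTSS (n + m + m).+2) (chebTSS n); ring.
Qed.

(** By the product formula, [T_(a i)] as a sequence in [a] satisfies the Chebyshev recurrence with
    [T_i] in place of ['X]. *)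
Lemma chebT_comp a i : T (a * i) = T a \Po T i.
Proof.
suff [] : T (a * i) = T a \Po T i /\ T (a.+1 * i) = T a.+1 \Po T i by [].
elim: a => [|a [IHa IHa1]].
  by rewrite mul0n mul1n /= comp_polyX -[1]polyC1 comp_polyC.
split=> //; rewrite chebTSS comp_polyB (raddfMn (comp_poly _)) /= comp_polyM comp_polyX.
by rewrite -IHa -IHa1 !mulSn !(addnC i) mulrC chebT_mul addrK.
Qed.

(* Bezout's identity gives [a i = m + (b + i n) j]; then
   [2 T_(a i) T_((b + i n) j) = T_(a i + (b + i n) j) + T_m] and
   [2 T_((a + j n) i) T_(b j) = T_(a i + (b + i n) j) + T_(m + 2 i j n)]. *)
Lemma chebT_shift i j n m : (0 < i)%N -> coprime i j ->
  exists p q p' q', T (m + 2 * i * j * n) =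
    T m + ((p \Po T i) * (q \Po T j) - (p' \Po T i) * (q' \Po T j)).
Proof.
move=> i_gt0 /(coprimeP _ i_gt0)[[u v] /= uv].
have {}uv : (u * i = v * j + 1)%N by lia.
pose a := (u * m + j * n)%N; pose b := (v * m)%N.
have ab : (a * i = m + (b + i * n) * j)%N.
  by rewrite /a /b mulnDl mulnAC uv; nia.
exists (T (a + j * n) *+ 2), (T b), (T a *+ 2), (T (b + i * n)).
rewrite !(raddfMn (comp_poly _)) /= -!chebT_comp !mulrnAl.
rewrite ab chebT_mul.
have -> : ((a + j * n) * i = m + 2 * i * j * n + b * j)%N by nia.
rewrite chebT_mul.
have -> : (m + 2 * i * j * n + b * j + b * j =
  m + (b + i * n) * j + (b + i * n) * j)%N by nia.
ring.
Qed.

(** * The subalgebra generated by the coordinates, and the embedding property *)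

Definition morph_image f p := exists G, subst_morph G f = p.

Lemma morph_image_coord f l : morph_image f (tnth f l).
Proof. by exists (mpolyX k (mnm1 l)); rewrite subst_morphX. Qed.

Lemma morph_imageB f p q :
  morph_image f p -> morph_image f q -> morph_image f (p - q).
Proof. by move=> [G <-] [H <-]; exists (G - H); rewrite subst_morphB. Qed.

Lemma morph_imageM f p q :
  morph_image f p -> morph_image f q -> morph_image f (p * q).
Proof. by move=> [G <-] [H <-]; exists (G * H); rewrite subst_morphM. Qed.

Lemma morph_image_comp f p q : morph_image f q -> morph_image f (p \Po q).
Proof. by move=> [G <-]; exists (mpoly_of_poly G p); rewrite subst_mpoly_of_poly. Qed.

Lemma embeddingX f : morph_image f 'X -> embedding f.
Proof. by move=> fX p; rewrite -(comp_polyXr p); exact: morph_image_comp. Qed.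

(* With [u n = 1 + 2 i j v], [T_u \Po T_n] and [T_1 = 'X] differ by an element
   of [k[T_i, T_j]]. *)
Lemma morph_imageX f i j n : (0 < i)%N -> coprime i j -> (0 < n)%N ->
    coprime n (2 * i * j) ->
    morph_image f (T i) -> morph_image f (T j) -> morph_image f (T n) ->
  morph_image f 'X.
Proof.
move=> i_gt0 co_ij n_gt0 /(coprimeP _ n_gt0)[[u v] /= uv] fi fj fn.
have {}uv : (u * n = 1 + 2 * i * j * v)%N by lia.
have [p [q [p' [q' def_T]]]] := chebT_shift v 1 i_gt0 co_ij.
have -> : 'X = (T u \Po T n) - ((p \Po T i) * (q \Po T j) - (p' \Po T i) * (q' \Po T j)).
  by rewrite -chebT_comp uv def_T addrK.
by repeat first [apply: morph_imageB | apply: morph_imageM | apply: morph_image_comp].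
Qed.

Lemma pgcd_eq1P i j n : (0 < i)%N -> (0 < j)%N -> coprime i j ->
  pgcd i j n = 1%N <-> coprime i n /\ coprime j n.
Proof.
rewrite /pgcd /coprime => i_gt0 j_gt0 /eqP->.
have : (0 < gcdn i n)%N by rewrite gcdn_gt0 i_gt0.
have : (0 < gcdn j n)%N by rewrite gcdn_gt0 j_gt0.
by move: (gcdn i n) (gcdn j n) => d e; lia.
Qed.

Lemma chebK_embedding i j f : (0 < i)%N -> (0 < j)%N -> coprime i j ->
  chebK k i j f -> embedding f.
Proof.
move=> i_gt0 j_gt0 co_ij [n [n_gt0 /(pgcd_eq1P n i_gt0 j_gt0 co_ij)[co_in co_jn] def_f]].
have fi : morph_image f (T i).
  by have := morph_image_coord f (inord 0); rewrite def_f (tnth_nth 0) inordK.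
have fj : morph_image f (T j).
  by have := morph_image_coord f (inord 1); rewrite def_f (tnth_nth 0) inordK.
have fn : morph_image f (T n).
  by have := morph_image_coord f (inord 2); rewrite def_f (tnth_nth 0) inordK.
apply: embeddingX; have [odd_n|even_n] := boolP (odd n).
  apply: (morph_imageX i_gt0 co_ij n_gt0) => //.
  by rewrite !coprimeMr coprimen2 odd_n !(coprime_sym n) co_in.
have odd_j : odd j.
  rewrite -coprimen2; apply: coprime_dvdr co_jn; by rewrite dvdn2.
(* The roles of [j] and [n] are exchanged: [j] is odd, hence invertible modulo [2 i n]. *)
apply: (morph_imageX i_gt0 co_in j_gt0) => //.
by rewrite !coprimeMr coprimen2 odd_j co_jn coprime_sym co_ij.
Qed.

(** * Degrees, infinitude of the family and reduction of the index *)

Lemma size_chebT n : (2%:R : k) != 0 -> size (T n) = n.+1.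
Proof.
move=> nz2; suff [] : size (T n) = n.+1 /\ size (T n.+1) = n.+2 by [].
elim: n => [|n [IHn IHn1]]; first by rewrite size_poly1 size_polyX.
split=> //; rewrite chebTSS.
(* As 2 is nonzero, [2 X T_(n + 1)] has degree [n + 2] and dominates [T_n]. *)
have sz2 : size ('X * T n.+1 *+ 2) = n.+3.
  rewrite -scaler_nat size_scale // mulrC size_mulX ?IHn1 //.
  by rewrite -size_poly_eq0 IHn1.
by rewrite size_polyDl sz2 // size_polyN IHn.
Qed.

(** The indices [1 + n i j] are coprime to [i] and [j], and the degree of the third coordinate tells
    the triples apart. *)
Lemma chebK_infinite i j : (2%:R : k) != 0 -> (0 < i)%N -> (0 < j)%N ->
  coprime i j -> infinite_set (chebK k i j).
Proof.
move=> nz2 i_gt0 j_gt0 co_ij fin_K; apply: infinite_nat.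
pose F n : morph k := [tuple T i; T j; T (n * (i * j)).+1].
have F_inj : injective F.
  move=> m n /(congr1 (fun f : morph k => size f`_2)).
  rewrite !size_chebT // => -[] /eqP.
  by rewrite eqn_pmul2r ?muln_gt0 ?i_gt0 // => /eqP.
apply: sub_finite_set (finite_preimage (in2W F_inj) fin_K) => n _ /=.
exists (n * (i * j)).+1; split=> //.
apply/(pgcd_eq1P _ i_gt0 j_gt0 co_ij)/andP.
rewrite ![coprime _ _.+1]coprime_sym -coprimeMr.
apply: coprime_dvdr (coprimeSn (n * (i * j))).
by rewrite dvdn_mull.
Qed.

Lemma alg_equiv_cheb_modn i j n : (0 < i)%N -> coprime i j ->
  alg_equiv [tuple T i; T j; T (n %% (2 * i * j))] [tuple T i; T j; T n].
Proof.
move=> i_gt0 co_ij; set m := (n %% _)%N.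
have -> : n = (m + 2 * i * j * (n %/ (2 * i * j)))%N.
  by rewrite addnC [(2 * i * j * _)%N]mulnC -divn_eq.
have [p [q [p' [q' ->]]]] := chebT_shift (n %/ (2 * i * j)) m i_gt0 co_ij.
exact: alg_equiv_add.
Qed.

End Chebyshev.

(** * Polynomial automorphisms as homeomorphisms of real 3-space *)

Section Topology.
Variable R : realType.
Implicit Types f g h : morph R.

Local Open Scope classical_set_scope.

Lemma continuous_meval n (P : mpoly n R) :
  continuous (fun v : 'rV[R]_n => meval (v 0) P).
Proof.
elim/mpolyind: P => [|c m P _ _ contP] v.
  rewrite (_ : (fun _ => _) = cst 0); last by apply/funext => w; rewrite meval0.
  exact: cst_continuous.
pose mono (w : 'rV[R]_n) := \prod_(l < n) w 0 l ^+ m l.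
rewrite (_ : (fun _ => _) =
    (cst c \* mono) \+ (fun w : 'rV[R]_n => meval (w 0) P)); last first.
  by apply/funext => w; rewrite mevalD mevalZ mevalX.
apply: continuousD; last exact: contP.
apply: continuousM; first exact: cst_continuous.
apply: continuous_big => [|l _ w]; first exact: mul_continuous.
apply: (@continuous_comp _ _ _ (fun w : 'rV[R]_n => w 0 l) (fun x => x ^+ m l)).
  exact: coord_continuous.
exact: exprn_continuous.
Qed.


Lemma continuous_row n (T : topologicalType) (F : 'I_n -> T -> R) :
  (forall l, continuous (F l)) -> continuous (fun t => \row_l F l t).
Proof.
move=> contF t A [B nbhsB subA].
(* Neighbourhoods of a row are given entrywise; finitely many conditions on [s] still define a
   neighbourhood of [t]. *)
apply: filterS (_ : nbhs t [set s | forall l, B 0 l (F l s)]) => [s Bs|].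
  by apply: subA => i l; rewrite ord1 mxE.
apply: filter_forall => l; apply: contF.
by have := nbhsB 0 l; rewrite mxE.
Qed.

Definition eval_endo (a : endo R) (v : 'rV[R]_3) : 'rV[R]_3 :=
  \row_l meval (v 0) (tnth a l).

Lemma eval_comp_endo a b v : eval_endo (comp_endo a b) v = eval_endo a (eval_endo b v).
Proof.
apply/rowP => l; rewrite !mxE tnth_mktuple comp_mpoly_meval.
by apply: meval_eq => s; rewrite mxE.
Qed.

Lemma eval_id_endo v : eval_endo (id_endo R) v = v.
Proof. by apply/rowP => l; rewrite mxE tnth_mktuple mevalXU. Qed.

Lemma horner_subst_morph (G : mpoly 3 R) f t :
  (subst_morph G f).[t] = meval (fun l => (tnth f l).[t]) G.
Proof.
apply: (@eq_mpoly_rmorphism _ _ _ (horner_eval t \o mmap (@polyC R) (tnth f))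
  (meval (fun l => (tnth f l).[t]))) G => [c|l] /=.
  by rewrite mmapC mevalC /horner_eval hornerC.
by rewrite mmapX mmap1U mevalXU.
Qed.

Lemma poly_automorphism_homeo a : poly_automorphism a -> homeomorphism (eval_endo a).
Proof.
have cont b : continuous (eval_endo b).
  by apply: continuous_row => l; exact: continuous_meval.
move=> [b [ab ba]]; split=> //; exists (eval_endo b); split=> // v.
  by rewrite -eval_comp_endo ba eval_id_endo.
by rewrite -eval_comp_endo ab eval_id_endo.
Qed.

Lemma alg_top_equiv f g : alg_equiv f g -> top_equiv f g.
Proof.
move=> [a [/poly_automorphism_homeo homeo_a <-]]; exists (eval_endo a); split=> //.
(* The homeomorphism respects parameters: the point at [t] on the first line goes to the point at
   [t] on the second. *)
have E t : eval_endo a (\row_l (tnth f l).[t]) = \row_l (tnth (act_endo a f) l).[t].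
  apply/rowP => l; rewrite !mxE tnth_mktuple horner_subst_morph.
  by apply: meval_eq => s; rewrite mxE.
apply/seteqP; split=> [_ [_ [t _ <-] <-]|_ [t _ <-]].
  by exists t; rewrite ?E.
by exists (\row_l (tnth f l).[t]) => //; exists t.
Qed.

Lemma top_equiv_trans g f h : top_equiv f g -> top_equiv g h -> top_equiv f h.
Proof.
move=> [a [[conta [a' [conta' aK a'K]]] fg]] [b [[contb [b' [contb' bK b'K]]] gh]].
exists (b \o a); split; last by rewrite -image_comp fg.
split; first by move=> v; apply: continuous_comp; [exact: conta|exact: contb].
exists (a' \o b'); split; last 2 first.
- exact: can_comp.
- exact: can_comp.
by move=> v; apply: continuous_comp; [exact: contb'|exact: conta'].
Qed.

Lemma eq_knot_type f g : alg_equiv f g -> knot_type f = knot_type g.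
Proof.
move=> fg; apply/seteqP; split=> h [emb_h eqh]; split=> //.
  exact: top_equiv_trans (alg_top_equiv (alg_equiv_sym fg)) eqh.
exact: top_equiv_trans (alg_top_equiv fg) eqh.
Qed.

End Topology.

(** * Finiteness of the number of classes *)

(** [C] stands for any invariant of algebraic equivalence, so one count serves both algebraic
    classes and knot types: there are at most [2 i j] values, one per residue of the index. *)
Lemma finite_chebK_image (k : fieldType) (U : Type) (C : morph k -> U) i j :
    (0 < i)%N -> coprime i j -> (0 < j)%N ->
    (forall f g, alg_equiv f g -> C f = C g) ->
  finite_set [set C f | f in chebK k i j]%classic.
Proof.
move=> i_gt0 co_ij j_gt0 eqC.
pose F n := C [tuple chebT k i; chebT k j; chebT k n].
apply: sub_finite_set (finite_image F (finite_II (2 * i * j))).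
(* The triple indexed by the residue need not belong to the family, as the residue may be 0; only
   its value under [C] matters. *)
move=> _ [f [n [_ _ ->]] <-]; exists (n %% (2 * i * j))%N.
  by rewrite /= ltn_mod !muln_gt0 i_gt0.
exact/eqC/alg_equiv_cheb_modn.
Qed.

Theorem mainTheorem3 (i j : nat) (hi : (0 < i)%N) (hj : (0 < j)%N)
    (hij : gcdn i j = 1%N) :
  (forall k : fieldType, [pchar k]%R =i pred0 ->
     [/\ forall f : morph k, chebK k i j f -> embedding f,
         infinite_set (chebK k i j)
       & finite_set [set alg_class f | f in chebK k i j]%classic])
  /\ (forall R : realType, t_finite (chebK R i j)).
Proof.
have co_ij : coprime i j by apply/eqP.
split=> [k char0|R]; last exact: finite_chebK_image (@eq_knot_type R).
have nz2 : (2%:R : k) != 0.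
  by have := char0 2%N; rewrite !inE => /negbT.
split; last exact: finite_chebK_image (@eq_alg_class k).
  by move=> f; exact: chebK_embedding.
exact: chebK_infinite.
Qed.
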